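(* Let $\mathcal{L}$ be a linear and complete residuated lattice with underlying set $L$, let $\varepsilon \in L$, $k \in \mathbb{N}$, let $\mathcal{A} = \langle Q, \Sigma, I, \delta, F\rangle$ be a fuzzy automaton over $\mathcal{L}$ and let $Z$ be an $\varepsilon$-FPO on $Q$. (a) If $Z$ is a right $\varepsilon$-invariance on $\mathcal{A}$, then $\mathcal{A}_{Z,\varepsilon}$ is $\varepsilon$-equivalent to $\mathcal{A}$, which means $\mathbf{L}(\mathcal{A}_{Z,\varepsilon}) =_\varepsilon \mathbf{L}(\mathcal{A})$. (b) If $Z$ is a right $(\varepsilon,k)$-invariance on $\mathcal{A}$, then $\mathcal{A}_{Z,\varepsilon}$ is $(\varepsilon,k)$-equivalent to $\mathcal{A}$, which means $\mathbf{L}^{\leq k}(\mathcal{A}_{Z,\varepsilon}) =_\varepsilon \mathbf{L}^{\leq k}(\mathcal{A})$.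
   Context: A residuated lattice is $\mathcal{L} = \langle L, \leq, \land, \lor, \otimes, \to, 0, 1\rangle$ where $\langle L,\leq,\land,\lor,0,1\rangle$ is a lattice with least element $0$ and greatest element $1$, $\langle L,\otimes,1\rangle$ is a commutative monoid, and $x \otimes y \leq z$ iff $x \leq (y \to z)$ for all $x,y,z\in L$. It is complete (linear) if the lattice is complete (linearly ordered). Fuzzy sets. A fuzzy subset of a nonempty set $X$ is a function $X \to L$; a fuzzy relation on $X$ is a fuzzy subset of $X\times X$. Composition $\circ$ is sup-$\otimes$ composition: $f \circ g = \sup_x f(x)\otimes g(x) \in L$, $(f\circ r)(x) = \sup_y f(y)\otimes r(y,x)$, $(r\circ f)(x)=\sup_y r(x,y)\otimes f(y)$, $(r\circ s)(x,y)=\sup_z r(x,z)\otimes s(z,y)$. $id_X(x,x)=1$ and $id_X(x,y)=0$ for $x\ne y$; $r$ is reflexive if $id_X \leq r$ pointwise. $\varepsilon$-notions. For $x,y\in L$: $x \le_\varepsilon y$ iff $x\leq y$ or $x \leq \varepsilon$; $x =_\varepsilon y$ iff $x\le_\varepsilon y$ and $y \le_\varepsilon x$; $x\otimes_\varepsilon y = x\otimes y$ if $x \otimes y>\varepsilon$ and $=\varepsilon$ otherwise; $\bigvee_\varepsilon A = \sup(A\cup\{\varepsilon\})$ for $A\subseteq L$. The relations $\le_\varepsilon$, $=_\varepsilon$ on fuzzy sets are pointwise. The composition $\circ_\varepsilon$ is defined like $\circ$ (in all four cases) with $\sup,\otimes$ replaced by $\bigvee_\varepsilon,\otimes_\varepsilon$;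 it is associative. The $\varepsilon$-truncation $f_\varepsilon$ of $f$ is $f_\varepsilon(a)=f(a)$ if $f(a)>\varepsilon$ and $f_\varepsilon(a)=\varepsilon$ otherwise. A fuzzy relation $r$ on $X$ is an $\varepsilon$-FPO (fuzzy $\varepsilon$-pre-order) if it is reflexive, $r\circ_\varepsilon r \le_\varepsilon r$, and $r = r_\varepsilon$. Automata. A fuzzy automaton over $\mathcal{L}$ is $\mathcal{A}=\langle Q,\Sigma,I,\delta,F\rangle$ with $Q$ a nonempty (possibly infinite) set of states, $\Sigma$ a finite nonempty alphabet, $I,F: Q\to L$, and $\delta: Q\times\Sigma\times Q\to L$. For words $w$: $\delta_\epsilon = id_Q$ ($\epsilon$ the empty word), $\delta_\sigma(p,q)=\delta(p,\sigma,q)$, $\delta_{\sigma u}=\delta_\sigma\circ\delta_u$. $F_w = \delta_w\circ F$. The recognized language is $\mathbf{L}(\mathcal{A})(w) = I\circ\delta_w\circ F$, and $\mathbf{L}^{\leq k}(\mathcal{A})(w)=\mathbf{L}(\mathcal{A})(w)$ if $|w|\leq k$, $=0$ otherwise. A reflexive fuzzy relation $Z$ on $Q$ is a right $\varepsilon$-invariance on $\mathcal{A}$ if $Z\circ F_w =_\varepsilon F_w$ for all $w\in\Sigma^*$, and a right $(\varepsilon,k)$-invariance if this holds for all $w\in \Sigma^*$ with $|w|\leq k$. Afterset automaton. For $q\in Q$ let $Z_q(p)=Z(q,p)$, $Z^q(p)=Z(p,q)$, and $Q/Z=\{Z_q\mid q\in Q\}$. For an $\varepsilon$-FPO $Z$,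 $\mathcal{A}_{Z,\varepsilon}=\langle Q',\Sigma,I',\delta',F'\rangle$ with $Q'=Q/Z$, $I'(Z_q)=I\circ_\varepsilon Z^q$, $\delta'(Z_q,\sigma,Z_p)=Z_q\circ_\varepsilon\delta_\sigma\circ_\varepsilon Z^p$, $F'(Z_p)=Z_p\circ_\varepsilon F$ (well defined because, for an $\varepsilon$-FPO, $Z_p=Z_q$ iff $Z^p=Z^q$). *)

(* Defs.v *)
From HB Require Import structures.
From mathcomp Require Import all_boot all_order.
From mathcomp Require Import boolp classical_sets.

Set Implicit Arguments.
Unset Strict Implicit.
Unset Printing Implicit Defensive.

Import Order.TTheory.
Local Open Scope classical_set_scope.
Local Open Scope order_scope.

HB.mixin Record isResiduated (d : Order.disp_t) (L : Type)
    of Order.TBLattice d L := {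
  rmul : L -> L -> L;
  rimp : L -> L -> L;
  rmulA : associative rmul;
  rmulC : commutative rmul;
  rmul1x : left_id \top rmul;
  rmul_adj : forall x y z : L, (rmul x y <= z) = (x <= rimp y z);
}.

#[short(type="residuatedLatticeType")]
HB.structure Definition ResiduatedLattice (d : Order.disp_t) :=
  { L of isResiduated d L & Order.TBLattice d L }.

#[short(type="linearResiduatedLatticeType")]
HB.structure Definition LinearResiduatedLattice (d : Order.disp_t) :=
  { L of ResiduatedLattice d L & Order.TBTotal d L }.

Notation "x ⊗ y" := (rmul x y) (at level 40, left associativity).

Definition complete_lattice (d : Order.disp_t) (L : porderType d) : Prop :=
  forall S : set L, supremums S !=set0 /\ infimums S !=set0.

Section Fuzzy.
Context {d : Order.disp_t} {L : residuatedLatticeType d}.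

(* Only meaningful as the least upper bound of S when L is complete. *)
Definition sup (S : set L) : L := supremum \bot S.

Definition fuzzy (X : Type) := X -> L.
Definition fuzzyrel (X : Type) := X -> X -> L.

Definition fid (X : Type) : fuzzyrel X :=
  fun x y => if `[< x = y >] then \top else \bot.

Definition freflexive (X : Type) (r : fuzzyrel X) : Prop :=
  forall x y, @fid X x y <= r x y.

(* Composition of: s = set and set, sr = set and relation,
   rs = relation and set, r = two relations. *)
Definition comp_s (X : Type) (f g : fuzzy X) : L :=
  sup [set f x ⊗ g x | x in [set: X]].
Definition comp_sr (X : Type) (f : fuzzy X) (r : fuzzyrel X) : fuzzy X :=
  fun x => sup [set f y ⊗ r y x | y in [set: X]].
Definition comp_rs (X : Type) (r : fuzzyrel X) (f : fuzzy X) : fuzzy X :=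
  fun x => sup [set r x y ⊗ f y | y in [set: X]].
Definition comp_r (X : Type) (r s : fuzzyrel X) : fuzzyrel X :=
  fun x y => sup [set r x z ⊗ s z y | z in [set: X]].

Section Epsilon.
Variable eps : L.

Definition ele (x y : L) : Prop := x <= y \/ x <= eps.
Definition eeq (x y : L) : Prop := ele x y /\ ele y x.
Definition emul (x y : L) : L := if eps < x ⊗ y then x ⊗ y else eps.
Definition esup (S : set L) : L := sup (S `|` [set eps]).

Definition fele (X : Type) (f g : fuzzy X) : Prop := forall x, ele (f x) (g x).
Definition feeq (X : Type) (f g : fuzzy X) : Prop := forall x, eeq (f x) (g x).
Definition rele (X : Type) (r s : fuzzyrel X) : Prop :=
  forall x y, ele (r x y) (s x y).

Definition ecomp_s (X : Type) (f g : fuzzy X) : L :=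
  esup [set emul (f x) (g x) | x in [set: X]].
Definition ecomp_sr (X : Type) (f : fuzzy X) (r : fuzzyrel X) : fuzzy X :=
  fun x => esup [set emul (f y) (r y x) | y in [set: X]].
Definition ecomp_rs (X : Type) (r : fuzzyrel X) (f : fuzzy X) : fuzzy X :=
  fun x => esup [set emul (r x y) (f y) | y in [set: X]].
Definition ecomp_r (X : Type) (r s : fuzzyrel X) : fuzzyrel X :=
  fun x y => esup [set emul (r x z) (s z y) | z in [set: X]].

Definition rtrunc (X : Type) (r : fuzzyrel X) : fuzzyrel X :=
  fun x y => if eps < r x y then r x y else eps.

Definition eFPO (X : Type) (r : fuzzyrel X) : Prop :=
  [/\ freflexive r, rele (ecomp_r r r) r & r = rtrunc r].

End Epsilon.
End Fuzzy.

Arguments fuzzy {d} L X.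
Arguments fuzzyrel {d} L X.
Arguments fid {d L X}.

Record fautomaton (d : Order.disp_t) (L : residuatedLatticeType d)
    (Sigma : finType) := FAutomaton {
  state : Type;
  state_nonempty : inhabited state;
  init : fuzzy L state;
  trans : state -> Sigma -> state -> L;
  final : fuzzy L state;
}.

Arguments state {d L Sigma} A : rename.
Arguments init {d L Sigma} A _ : rename.
Arguments trans {d L Sigma} A _ _ _ : rename.
Arguments final {d L Sigma} A _ : rename.

Section Automata.
Context {d : Order.disp_t} {L : residuatedLatticeType d} {Sigma : finType}.
Implicit Type A : fautomaton L Sigma.

Definition trans1 A (a : Sigma) : fuzzyrel L (state A) :=
  fun p q => trans A p a q.

Arguments trans1 A a : clear implicits.

Fixpoint transw A (w : seq Sigma) : fuzzyrel L (state A) :=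
  match w with
  | [::] => fid
  | a :: u => comp_r (trans1 A a) (@transw A u)
  end.

Arguments transw A w : clear implicits.

Definition finalw A (w : seq Sigma) : fuzzy L (state A) :=
  comp_rs (transw A w) (final A).

Arguments finalw A w : clear implicits.

Definition lang A : fuzzy L (seq Sigma) :=
  fun w => comp_s (comp_sr (init A) (transw A w)) (final A).

Definition lang_le (k : nat) A : fuzzy L (seq Sigma) :=
  fun w => if (size w <= k)%N then lang A w else \bot.

Definition right_inv (eps : L) A (Z : fuzzyrel L (state A)) : Prop :=
  freflexive Z /\
  forall w : seq Sigma, feeq eps (comp_rs Z (finalw A w)) (finalw A w).

Definition right_inv_le (eps : L) (k : nat) A (Z : fuzzyrel L (state A)) :
    Prop :=
  freflexive Z /\
  forall w : seq Sigma, (size w <= k)%N ->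
    feeq eps (comp_rs Z (finalw A w)) (finalw A w).

Definition eequiv (eps : L) (A B : fautomaton L Sigma) : Prop :=
  feeq eps (lang A) (lang B).

Definition eequiv_le (eps : L) (k : nat) (A B : fautomaton L Sigma) : Prop :=
  feeq eps (lang_le k A) (lang_le k B).

End Automata.

Arguments trans1 {d L Sigma} A a.
Arguments transw {d L Sigma} A w.
Arguments finalw {d L Sigma} A w.
Arguments lang {d L Sigma} A.
Arguments lang_le {d L Sigma} k A.
Arguments right_inv {d L Sigma} eps A Z.
Arguments right_inv_le {d L Sigma} eps k A Z.

Section Afterset.
Context {d : Order.disp_t} {L : residuatedLatticeType d}.

Section Quotient.
Context {X : Type}.
Variable Z : fuzzyrel L X.

Definition afterset (q : X) : fuzzy L X := fun p => Z q p.
Definition foreset (q : X) : fuzzy L X := fun p => Z p q.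

Definition quot : Type := {f : fuzzy L X | f \in range afterset}.

Definition class_of (q : X) : quot :=
  SigSub (mem_set (imageT afterset q)).

Lemma quotP (c : quot) : exists q, class_of q = c.
Proof.
case: c => f hf; have [q _ qf] := set_mem hf.
by exists q; apply/val_inj.
Qed.

Definition repr (c : quot) : X := projT1 (cid (quotP c)).

Lemma reprK (c : quot) : class_of (repr c) = c.
Proof. exact: projT2 (cid (quotP c)). Qed.

Lemma quot_nonempty : inhabited X -> inhabited quot.
Proof. by case=> q; apply: (inhabits (class_of q)). Qed.

End Quotient.

(* The values on a class Z_q are computed from an arbitrary representative of
   the class; for an eps-FPO they do not depend on it, see afterset_autE. *)
Definition afterset_aut {Sigma : finType} (eps : L) (A : fautomaton L Sigma)
    (Z : fuzzyrel L (state A)) : fautomaton L Sigma :=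
  {| state := quot Z;
     state_nonempty := quot_nonempty Z (state_nonempty A);
     init := fun c => ecomp_s eps (init A) (foreset Z (repr c));
     trans := fun c a c' =>
       ecomp_s eps (ecomp_sr eps (afterset Z (repr c)) (trans1 A a))
                   (foreset Z (repr c'));
     final := fun c => ecomp_s eps (afterset Z (repr c)) (final A) |}.

Arguments afterset_aut {Sigma} eps A Z.

Lemma supP (S : set L) : complete_lattice L -> supremums S (sup S).
Proof.
move=> cL; have [[s Ss] _] := cL S; rewrite /sup /supremum.
case: eqP => [->|_]; last exact: xgetI Ss.
by split=> [x //|x _]; apply: le0x.
Qed.

Lemma sup_ge (S : set L) (x : L) : complete_lattice L -> S x -> x <= sup S.
Proof. by move=> cL Sx; case: (supP S cL) => /(_ _ Sx). Qed.

Lemma rmulx1 (x : L) : x ⊗ \top = x.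
Proof. by rewrite rmulC rmul1x. Qed.

Lemma foreset_le (X : Type) (eps : L) (Z : fuzzyrel L X) (p q : X) :
  complete_lattice L -> eFPO eps Z -> afterset Z p = afterset Z q ->
  forall x, Z x p <= Z x q.
Proof.
move=> cL [Zr Zt ZE] pq x.
have Zpq : Z p q = \top.
  have := Zr q q; rewrite /fid; case: asboolP => // _; rewrite le1x => /eqP <-.
  exact: (congr1 (fun f => f q) pq).
have Zge y z : eps <= Z y z.
  by rewrite ZE /rtrunc; case: ifP => // /ltW.
have [lt|nlt] := boolP (eps < Z x p); last first.
  have -> : Z x p = eps by rewrite ZE /rtrunc (negbTE nlt).
  exact: Zge.
have le : Z x p <= ecomp_r eps Z Z x q.
  apply: sup_ge => //; left; exists p => //.
  by rewrite /emul Zpq rmulx1 lt.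
case: (Zt x q) => [/(le_trans le)//|/(le_trans le) le'].
by move: (lt_le_trans lt le'); rewrite ltxx.
Qed.

Lemma foreset_eq (X : Type) (eps : L) (Z : fuzzyrel L X) (p q : X) :
  complete_lattice L -> eFPO eps Z -> afterset Z p = afterset Z q ->
  foreset Z p = foreset Z q.
Proof.
move=> cL hZ pq; apply/funext => x; apply/le_anti/andP; split.
  exact: (foreset_le cL hZ pq).
exact: (foreset_le cL hZ (esym pq)).
Qed.

Lemma afterset_autE (Sigma : finType) (eps : L) (A : fautomaton L Sigma)
    (Z : fuzzyrel L (state A)) :
  complete_lattice L -> eFPO eps Z ->
  let B := afterset_aut eps A Z in
  [/\ forall q, init B (class_of Z q) =
        ecomp_s eps (init A) (foreset Z q),
      forall q a p, trans B (class_of Z q) a (class_of Z p) =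
        ecomp_s eps (ecomp_sr eps (afterset Z q) (trans1 A a)) (foreset Z p) &
      forall p, final B (class_of Z p) =
        ecomp_s eps (afterset Z p) (final A)].
Proof.
move=> cL hZ /=.
have aE q : afterset Z (repr (class_of Z q)) = afterset Z q.
  exact: (congr1 val (reprK (class_of Z q))).
have fE q : foreset Z (repr (class_of Z q)) = foreset Z q.
  exact: (foreset_eq cL hZ (aE q)).
by split=> *; rewrite ?aE ?fE.
Qed.

End Afterset.

Arguments afterset_aut {d L Sigma} eps A Z.

(* Main.v *)
Require Import Defs.
From mathcomp Require Import all_boot all_order.
From mathcomp Require Import boolp classical_sets.

(** Truncation at [eps] is compatible with multiplication and with suprema, so
    up to [=_eps] the operations of the afterset automaton [B] may be computed
    with the ordinary composition.  By induction on [w], the invariance of [Z]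
    gives [F^B_w(Z_q) =_eps F_w(q)]: for [w = a u] the left-hand side is, up to
    [eps], [Z o delta_a o Z o F_u =_eps Z o delta_a o F_u = Z o F_w =_eps F_w].
    Only words of length at most [|w|] occur, so the same induction serves both
    parts.  Finally [L(B)(w) =_eps I o Z o F_w =_eps I o F_w = L(A)(w)]. *)

Set Implicit Arguments.
Unset Strict Implicit.
Unset Printing Implicit Defensive.

Import Order.TTheory.
Local Open Scope classical_set_scope.
Local Open Scope order_scope.

(** Every composition is convertible to such an indexed supremum, so its terms can be rewritten
    pointwise. *)
Definition isup (d : Order.disp_t) (L : residuatedLatticeType d) (X : Type)
  (f : X -> L) : L := sup [set f x | x in [set: X]].

(** * Suprema and products in a complete residuated lattice *)

Section Residuated.
Context {d : Order.disp_t} {L : residuatedLatticeType d}.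
Hypothesis cL : complete_lattice L.

Lemma rmul_le (x x' y y' : L) : x <= x' -> y <= y' -> x ⊗ y <= x' ⊗ y'.
Proof.
move=> xx' yy'; apply: (@le_trans _ _ (x' ⊗ y)).
  by rewrite rmul_adj (le_trans xx')// -rmul_adj.
by rewrite (rmulC x') (rmulC x') rmul_adj (le_trans yy')// -rmul_adj.
Qed.

Lemma rmul0x (x : L) : \bot ⊗ x = \bot.
Proof. by apply/le_anti; rewrite le0x andbT rmul_adj le0x. Qed.

Lemma rmul_le_r (x y : L) : x ⊗ y <= y.
Proof. by rewrite -[leRHS]rmul1x rmul_le ?lex1. Qed.

Lemma sup_leP (S : set L) y : sup S <= y <-> (forall x, S x -> x <= y).
Proof.
split=> [Sy x Sx|Sy]; first exact: le_trans (sup_ge cL Sx) Sy.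
by have [_] := supP S cL; apply.
Qed.

Lemma isup_leP (X : Type) (f : X -> L) y :
  isup f <= y <-> (forall x, f x <= y).
Proof.
rewrite /isup; split=> [/sup_leP h x|h]; first by apply: h; exists x.
by apply/sup_leP => _ [x _ <-].
Qed.

Lemma isup_eqP (X Y : Type) (f : X -> L) (g : Y -> L) :
  (forall y, (forall x, f x <= y) <-> (forall x, g x <= y)) -> isup f = isup g.
Proof.
by move=> fg; apply/le_anti/andP; split; apply/isup_leP/fg/isup_leP.
Qed.

(** By residuation, multiplication by [z] is a left adjoint and hence preserves suprema. *)
Lemma isup_mull (X : Type) (f : X -> L) z :
  isup f ⊗ z = isup (fun x => f x ⊗ z).
Proof.
apply/le_anti/andP; split.
  rewrite rmul_adj; apply/isup_leP => x; rewrite -rmul_adj.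
  by move: x; apply/isup_leP.
apply/isup_leP => x; apply: rmul_le => //.
by move: x; apply/isup_leP.
Qed.

Lemma isup_mulr (X : Type) (f : X -> L) z :
  z ⊗ isup f = isup (fun x => z ⊗ f x).
Proof.
by rewrite rmulC isup_mull; congr isup; apply/funext => x; rewrite rmulC.
Qed.

Lemma isup_exchange (X Y : Type) (f : X -> Y -> L) :
  isup (fun x => isup (f x)) = isup (fun y => isup (f ^~ y)).
Proof.
apply: isup_eqP => z; split=> h u; apply/isup_leP => v;
  by have /isup_leP := h v; apply.
Qed.

(** Serves to replace suprema over classes by suprema over states, with [h] the map [class_of Z]. *)
Lemma isup_surj (X Y : Type) (h : X -> Y) (f : Y -> L) :
  (forall y, exists x, h x = y) -> isup f = isup (fun x => f (h x)).
Proof.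
by move=> hS; apply: isup_eqP => z; split=> fz y //; have [x <-] := hS y.
Qed.

(** Associativity of composition, the law behind each regrouping below. *)
Lemma isup_mulA (X Y : Type) (f : X -> L) (r : X -> Y -> L) (g : Y -> L) :
  isup (fun y => isup (fun x => f x ⊗ r x y) ⊗ g y) =
  isup (fun x => f x ⊗ isup (fun y => r x y ⊗ g y)).
Proof.
under [in RHS]eq_fun do rewrite isup_mulr.
under eq_fun do rewrite isup_mull.
rewrite isup_exchange; congr isup; apply/funext => x.
by congr isup; apply/funext => y; rewrite rmulA.
Qed.

Lemma isup_fidl (X : Type) (f : fuzzy L X) x :
  isup (fun y => fid x y ⊗ f y) = f x.
Proof.
apply/le_anti/andP; split.
  apply/isup_leP => y; rewrite /fid; case: asboolP => [->|_].
    by rewrite rmul1x.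
  by rewrite rmul0x le0x.
have /isup_leP/(_ x) := lexx (isup (fun y => fid x y ⊗ f y)).
by rewrite {1}/fid asboolT // rmul1x.
Qed.

Section FinalWeights.
Context {Sigma : finType}.
Implicit Types (B : fautomaton L Sigma) (w : seq Sigma).

Lemma finalw_nil B q : finalw B [::] q = final B q.
Proof. exact: isup_fidl. Qed.

Lemma finalw_cons B a w q :
  finalw B (a :: w) q = isup (fun p => trans B q a p ⊗ finalw B w p).
Proof. exact: isup_mulA. Qed.

Lemma lang_finalw B w : lang B w = isup (fun q => init B q ⊗ finalw B w q).
Proof. exact: isup_mulA. Qed.

End FinalWeights.

End Residuated.

(** * Compatibility of [=_eps] with products and suprema *)

Section EpsilonEquality.
Context {d : Order.disp_t} {L : linearResiduatedLatticeType d}.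
Hypothesis cL : complete_lattice L.
Variable eps : L.

Lemma ele_trans (y x z : L) : ele eps x y -> ele eps y z -> ele eps x z.
Proof.
move=> [xy|]; last by right.
by case=> [yz|ye]; [left|right]; apply: le_trans xy _.
Qed.

Lemma eeq_refl (x : L) : eeq eps x x.
Proof. by split; left. Qed.

Lemma eeq_trans (y x z : L) : eeq eps x y -> eeq eps y z -> eeq eps x z.
Proof. by move=> [xy yx] [yz zy]; split; apply: (@ele_trans y). Qed.

(** A product lies below each of its factors, so one factor below [eps] brings the whole product
    below [eps]. *)
Lemma ele_mul (x x' y y' : L) :
  ele eps x x' -> ele eps y y' -> ele eps (x ⊗ y) (x' ⊗ y').
Proof.
move=> [xx'|xe]; last by right; rewrite rmulC (le_trans (rmul_le_r _ _)).
case=> [yy'|ye]; last by right; rewrite (le_trans (rmul_le_r _ _)).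
by left; apply: rmul_le.
Qed.

Lemma eeq_mul (x x' y y' : L) :
  eeq eps x x' -> eeq eps y y' -> eeq eps (x ⊗ y) (x' ⊗ y').
Proof. by move=> [? ?] [? ?]; split; apply: ele_mul. Qed.

(* Linearity is needed here: [y] and [eps] must be comparable. *)
Lemma ele_sup (S : set L) y :
  (forall x, S x -> ele eps x y) -> ele eps (sup S) y.
Proof.
move=> Sy; case: (leP eps y) => ey; [left|right]; apply/(sup_leP cL) => x /Sy [] //.
  by move/le_trans; apply.
by move=> xy; apply: le_trans xy (ltW ey).
Qed.

Lemma ele_isup (X : Type) (f g : X -> L) :
  (forall x, ele eps (f x) (g x)) -> ele eps (isup f) (isup g).
Proof.
move=> fg; apply: ele_sup => _ [x _ <-]; apply: ele_trans (fg x) _; left.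
by move: x; apply/(isup_leP cL).
Qed.

Lemma eeq_isup (X : Type) (f g : X -> L) :
  (forall x, eeq eps (f x) (g x)) -> eeq eps (isup f) (isup g).
Proof. by move=> fg; split; apply: ele_isup => x; case: (fg x). Qed.

Lemma eeq_emul (x y : L) : eeq eps (emul eps x y) (x ⊗ y).
Proof.
rewrite /emul; case: ltP => [_|h]; first exact: eeq_refl.
by split; right.
Qed.

Lemma eeq_esup (S : set L) : eeq eps (esup eps S) (sup S).
Proof.
split; apply: ele_sup => x.
  by case=> [Sx|->]; [left; apply: sup_ge|right].
by move=> Sx; left; apply: sup_ge => //; left.
Qed.

(** Truncation only alters values that are at most [eps], which [=_eps] does not distinguish. *)
Lemma eeq_esup_emul (X : Type) (f g : X -> L) :
  eeq eps (esup eps [set emul eps (f x) (g x) | x in [set: X]])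
          (isup (fun x => f x ⊗ g x)).
Proof.
apply: eeq_trans (eeq_esup _) _; apply: eeq_isup => x; exact: eeq_emul.
Qed.

(** * Weights and language of the afterset automaton *)

Section AftersetLanguage.
Context {Sigma : finType}.
Variables (A : fautomaton L Sigma) (Z : fuzzyrel L (state A)).
Hypothesis ZFPO : eFPO eps Z.
Let B := afterset_aut eps A Z.

(** For an [eps]-FPO the weight of a class does not depend on its representative, so it can be read
    off at [q]. *)
Lemma init_afterset_aut q :
  eeq eps (init B (class_of Z q)) (isup (fun p => init A p ⊗ Z p q)).
Proof. by have [-> _ _] := afterset_autE cL ZFPO; apply: eeq_esup_emul. Qed.

Lemma final_afterset_aut q :
  eeq eps (final B (class_of Z q)) (comp_rs Z (final A) q).
Proof. by have [_ _ ->] := afterset_autE cL ZFPO; apply: eeq_esup_emul. Qed.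

Lemma trans_afterset_aut q a p :
  eeq eps (trans B (class_of Z q) a (class_of Z p))
    (isup (fun y => isup (fun x => Z q x ⊗ trans A x a y) ⊗ Z y p)).
Proof.
have [_ -> _] := afterset_autE cL ZFPO.
apply: eeq_trans (eeq_esup_emul _ _) _; apply: eeq_isup => y.
by apply: eeq_mul (eeq_esup_emul _ _) (eeq_refl _).
Qed.

Variable k : nat.
Hypothesis Zinv : right_inv_le eps k A Z.

Lemma finalw_afterset_aut w q : (size w <= k)%N ->
  eeq eps (finalw B w (class_of Z q)) (finalw A w q).
Proof.
have [_ ZF] := Zinv.
elim: w q => [|a w IHw] q wk.
  rewrite finalw_nil //; apply: eeq_trans (final_afterset_aut q) _.
  have := ZF [::] wk q.
  by have -> : finalw A [::] = final A by apply/funext => p; apply: finalw_nil.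
have wk' : (size w <= k)%N by apply: ltnW.
(* Invariance is used backwards here, to put [Z] in front of the right-hand side as well. *)
apply: eeq_trans (ZF (a :: w) wk q).
have -> : comp_rs Z (finalw A (a :: w)) q =
    isup (fun y => isup (fun x => Z q x ⊗ trans A x a y) ⊗ finalw A w y).
  rewrite isup_mulA //; congr isup; apply/funext => x.
  by rewrite finalw_cons.
rewrite finalw_cons // (isup_surj cL _ (@Defs.quotP _ _ _ Z)).
(* Intermediate term [Z o delta_a o Z o F_w], with the induction hypothesis applied at every state
   [p]. *)
apply: (@eeq_trans (isup (fun p =>
    isup (fun y => isup (fun x => Z q x ⊗ trans A x a y) ⊗ Z y p)
    ⊗ finalw A w p))).
  apply: eeq_isup => p.
  by apply: eeq_mul (trans_afterset_aut q a p) (IHw p wk').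
(* After regrouping, the inner [Z] stands next to [F_w] and is absorbed by invariance for the
   shorter word. *)
rewrite isup_mulA //; apply: eeq_isup => y.
by apply: eeq_mul (eeq_refl _) (ZF w wk' y).
Qed.

Lemma lang_afterset_aut w : (size w <= k)%N -> eeq eps (lang B w) (lang A w).
Proof.
have [_ ZF] := Zinv.
move=> wk; rewrite !lang_finalw // (isup_surj cL _ (@Defs.quotP _ _ _ Z)).
apply: (@eeq_trans (isup (fun q =>
    isup (fun p => init A p ⊗ Z p q) ⊗ finalw A w q))).
  apply: eeq_isup => q.
  by apply: eeq_mul (init_afterset_aut q) (finalw_afterset_aut q wk).
rewrite isup_mulA //; apply: eeq_isup => p.
by apply: eeq_mul (eeq_refl _) (ZF w wk p).
Qed.

End AftersetLanguage.

End EpsilonEquality.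

Theorem theorem5p6 (d : Order.disp_t) (L : linearResiduatedLatticeType d)
    (Lcomplete : complete_lattice L)
    (eps : L) (k : nat)
    (Sigma : finType) (Sigma_nonempty : (0 < #|Sigma|)%N)
    (A : fautomaton L Sigma)
    (Z : fuzzyrel L (state A)) (ZFPO : eFPO eps Z) :
  (right_inv eps A Z -> eequiv eps (afterset_aut eps A Z) A) /\
  (right_inv_le eps k A Z -> eequiv_le eps k (afterset_aut eps A Z) A).
Proof.
split=> Zinv w.
  (* For a fixed word, its own length serves as the bound. *)
  apply: (@lang_afterset_aut _ _ _ _ _ _ _ _ (size w)) => //.
  by case: Zinv => Zr ZF; split=> // u _; apply: ZF.
(* On words longer than [k] both languages take the value [\bot]. *)
rewrite /lang_le; case: ifP => wk; last exact: eeq_refl.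
by apply: (@lang_afterset_aut _ _ _ _ _ _ _ _ k).
Qed.
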